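(* Fix $m,n\in\mathbb N$ and let $P=(P(d))_{d\in\mathbb N}$ be as in the context. (a) If $P$ is relatively well-spread, then for every function $\psi:\mathbb Z_+^n\to\mathbb R_+$, \[\mathrm{Leb}\big(W_{1,m}^P(\Psi)\big)>0 \implies \mathrm{Leb}\big(W_{n,m}^P(\psi)\big)>0.\] (b) If $P$ is relatively uniformly discrete, then for every bounded function $\psi:\mathbb Z_+^n\to\mathbb R_+$, \[\mathrm{Leb}\big(W_{1,m}^P(\Psi)\big)>0 \implies \mathrm{Leb}\big(W_{n,m}^P(\psi)\big)>0.\] Here $\Psi=\Psi_1$ is the function associated with $\psi$ as in the context.
   Context: Notation: $\mathbb N$ is the positive integers, $\mathbb Z_+$ the nonnegative integers, $\mathbb R_+$ the nonnegative reals. $|\cdot|$ is the maximum norm; all distances and balls $B(\mathbf x,r)$ (center $\mathbf x$, radius $r$) are with respect to it, and a ball of infinite radius is all of $\mathbb R^m$. $\mathrm{Leb}$ is Lebesgue measure. For a nonzero integer vector $\mathbf q$, $\gcd(\mathbf q)$ is the gcd of its entries. Setting: for each $d\in\mathbb N$, $P(d)\subset(\mathbb R/d\mathbb Z)^m$ is a nonempty finite set; for nonzero $\mathbf q\in\mathbb Z_+^n$, $P(\mathbf q)\subset\mathbb R^m$ is the lift (full preimage under $\mathbb R^m\to(\mathbb R/d\mathbb Z)^m$, $d=\gcd(\mathbf q)$) of $P(\gcd(\mathbf q))$. For nonzero $\mathbf q\in\mathbb Z_+^n$ (a row vector) and $r\in[0,\infty]$, let $A_{n,m}^P(\mathbf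 q,r)=\{\mathbf X\in M_{n\times m}(\mathbb R):\mathbf q\mathbf X\in B(\mathbf 0,r)+P(\mathbf q)\}$; this is $\mathbb Z^{nm}$-periodic and is regarded as a subset of the torus $\mathbb T^{nm}=M_{n\times m}(\mathbb R)/M_{n\times m}(\mathbb Z)$. For $\psi:\mathbb Z_+^n\to[0,\infty]$, $W_{n,m}^P(\psi)\subset\mathbb T^{nm}$ is the set of $\mathbf X$ lying in $A_{n,m}^P(\mathbf q,\psi(\mathbf q))$ for infinitely many $\mathbf q\in\mathbb Z_+^n$. In particular, for $\Psi:\mathbb N\to[0,\infty]$, $W_{1,m}^P(\Psi)\subset\mathbb T^m$ is the set of $\mathbf x$ with $d\mathbf x\in B(\mathbf 0,\Psi(d))+P(d)$ (lifted) for infinitely many $d\in\mathbb N$. For $\psi:\mathbb Z_+^n\to\mathbb R_+$ and $Q\ge1$ define $\Psi_Q:\mathbb N\to[0,\infty]$ by $\Psi_Q(d)=\big(\sum_{\mathbf q\in\mathbb Z_+^n,\ \gcd(\mathbf q)=d,\ |\mathbf q/\gcd(\mathbf q)|\ge Q}\psi(\mathbf q)^m\big)^{1/m}$, and $\Psi=\Psi_1$. Definition: $P$ is relatively uniformly discrete if there are $b,c>0$ such that for every $d\ge1$ there is $P'(d)\subset P(d)$ with $\#P'(d)\ge c\,\#P(d)$ and $|\mathbf p_1-\mathbf p_2|\ge b$ for all distinct $\mathbf p_1,\mathbf p_2$ in the lift of $P'(d)$ to $\mathbb R^m$. $P$ is relatively well-spread if moreover there is $a>0$ such that for all $d\ge1$,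 $|\mathbf p_1-\mathbf p_2|\ge ad/(\#P(d))^{1/m}$ for all distinct $\mathbf p_1,\mathbf p_2$ in the lift of $P'(d)$. *)

(* Defs.v *)
From HB Require Import structures.
From mathcomp Require Import all_boot all_order all_algebra finmap.
From mathcomp Require Import all_classical all_reals all_analysis.

Set Implicit Arguments.
Unset Strict Implicit.
Unset Printing Implicit Defensive.

Import Order.TTheory GRing.Theory Num.Theory.
Import numFieldNormedType.Exports.

Local Open Scope classical_set_scope.
Local Open Scope ring_scope.

Section LebesgueMeasure.
Context (R : realType).

(* k-dimensional Lebesgue measure, as the k-fold product of the Lebesgue
   measure of the line; like the library's product measure it is a total
   function, meaningful on the measurable sets. *)
Fixpoint lebesgue_tuple (k : nat) :
    set (k.-tuple (measurableTypeR R)) -> \bar R :=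
  match k with
  | 0 => dirac [tuple]
  | k'.+1 => pushforward ((@lebesgue_measure R) \x (@lebesgue_tuple k'))%E
               (fun u => [the k'.+1.-tuple (measurableTypeR R) of u.1 :: u.2])
  end.

Context (n m : nat).

Definition mx_of_tuple (t : (n * m).-tuple (measurableTypeR R)) :
    'M[R]_(n, m) :=
  vec_mx (\row_i tnth t i).

Definition unit_cube : set 'M[R]_(n, m) :=
  [set X | forall i j, 0 <= X i j < 1].

(* A subset of the torus M_{n x m}(R) / M_{n x m}(Z) is represented by its
   Z^{nm}-periodic preimage A in M_{n x m}(R); its measure is that of the trace
   of A on the fundamental domain [0, 1)^{nm}. *)
Definition torus_lebesgue (A : set 'M[R]_(n, m)) : \bar R :=
  lebesgue_tuple (mx_of_tuple @^-1` (A `&` unit_cube)).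

End LebesgueMeasure.

Section Approximation.
Context (R : realType).

Definition gcdv n (q : 'rV[nat]_n) : nat := \big[gcdn/0%N]_(i < n) q 0 i.

Definition natmx n (q : 'rV[nat]_n) : 'rV[R]_n := map_mx (fun k => k%:R) q.

(* The finite set P(d) in (R/dZ)^m is given by its representatives in
   [0, d)^m. The value of P at 0 is never used. *)
Definition torus_family m (P : nat -> {fset 'rV[R]_m}) : Prop :=
  forall d, (0 < d)%N ->
    P d != fset0 /\ forall p, p \in P d -> forall j, 0 <= p 0 j < d%:R.

Definition lift_torus m (d : nat) (S : {fset 'rV[R]_m}) : set 'rV[R]_m :=
  [set x | exists2 p, p \in S &
           exists z : 'rV[int]_m, x = p + d%:R *: map_mx intr z].

(* The norm of 'rV[R]_m is the maximum norm. *)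
Definition approx_set n m (P : nat -> {fset 'rV[R]_m}) (q : 'rV[nat]_n)
    (r : \bar R) : set 'M[R]_(n, m) :=
  [set X | exists2 p, lift_torus (gcdv q) (P (gcdv q)) p &
           (`|natmx q *m X - p|%:E < r)%E].

Definition W n m (P : nat -> {fset 'rV[R]_m}) (psi : 'rV[nat]_n -> \bar R) :
    set 'M[R]_(n, m) :=
  [set X | infinite_set
             [set q : 'rV[nat]_n | q != 0 /\ approx_set P q (psi q) X]].

(* The case n = 1: positive integers d are the nonzero q in 'rV[nat]_1. *)
Definition W1 m (P : nat -> {fset 'rV[R]_m}) (Psi : nat -> \bar R) :
    set 'M[R]_(1, m) :=
  W P (fun q : 'rV[nat]_1 => Psi (q 0 0)).

Definition PsiQ n (m : nat) (psi : 'rV[nat]_n -> R) (Q : R) (d : nat) :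
    \bar R :=
  ((\esum_(q in [set q : 'rV[nat]_n |
        gcdv q = d /\ Q <= `|(gcdv q)%:R^-1 *: natmx q|]%R)
      ((psi q ^+ m)%R)%:E) `^ (m%:R^-1)%R)%E.

Definition dist_separated m (b : R) (S : set 'rV[R]_m) : Prop :=
  forall p1 p2, S p1 -> S p2 -> p1 <> p2 -> b <= `|p1 - p2|.

Definition uniformly_discrete_subfamily m (b c : R)
    (P P' : nat -> {fset 'rV[R]_m}) : Prop :=
  forall d, (0 < d)%N ->
    [/\ (P' d `<=` P d)%fset,
        c * (#|` P d|)%:R <= (#|` P' d|)%:R
      & dist_separated b (lift_torus d (P' d))].

Definition relatively_uniformly_discrete m (P : nat -> {fset 'rV[R]_m}) :
    Prop :=
  exists b c : R, [/\ 0 < b, 0 < c &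
    exists P', uniformly_discrete_subfamily b c P P'].

Definition relatively_well_spread m (P : nat -> {fset 'rV[R]_m}) : Prop :=
  exists b c : R, [/\ 0 < b, 0 < c &
    exists2 P', uniformly_discrete_subfamily b c P P' &
    exists2 a : R, 0 < a &
    forall d, (0 < d)%N ->
      dist_separated (a * d%:R / ((#|` P d|)%:R `^ (m%:R^-1)))
        (lift_torus d (P' d))].

End Approximation.

(* Main.v *)
(* Write a nonzero q as d v with v primitive. Modulo 1, X |-> v X maps the
   uniform measure of T^{nm} to that of T^m, and X |-> v X, X |-> w X are
   independent for distinct primitive v, w >= 0, since these are not
   proportional. Cap Psi(d) at d / 2 and put R_d = Psi(d) / d. By Vitali's
   covering argument the balls B(p / d, R_d) with p in P(d), d > D contain a
   finite disjoint subfamily B_i of total measure bounded below in terms of Leb(W_1(Psi)) only. Replace B_i,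
   of index (d, p), by the preimages under X |-> v X of concentric balls B_{i,v}
   of radius at most psi(d v) / d, the sum over v of |B_{i,v}| being comparable
   to |B_i|. Two such preimages are independent if v differs and disjoint if v
   agrees, so by Bonferroni their union has measure bounded below uniformly in
   D. The points lying in such unions for every D belong to W(psi). *)

Require Import Defs.
From HB Require Import structures.
From mathcomp Require Import all_boot all_order all_algebra finmap.
From mathcomp Require Import all_classical all_reals all_analysis
  measurable_realfun.
From mathcomp Require Import ring lra zify.

Set Implicit Arguments.
Unset Strict Implicit.
Unset Printing Implicit Defensive.

Import Order.TTheory GRing.Theory Num.Theory.
Import numFieldNormedType.Exports.

Local Open Scope classical_set_scope.
Local Open Scope ring_scope.

(** * Uniform measure on the unit interval and one-periodic sets *)

Section UnitInterval.
Context (R : realType).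
Local Notation RR := (measurableTypeR R).
Local Notation leb := (@lebesgue_measure R).

(** The Haar measure of the circle when evaluated on periodic sets. It lives on the whole line, so a
    subset of the circle can stay a periodic subset of the reals. *)
Definition unif01 : set RR -> \bar R :=
  mrestr leb (measurable_itv `[(0 : R), 1[).

HB.instance Definition _ := Measure.on unif01.

Let unif01_setT : unif01 setT = 1%E.
Proof.
by rewrite /unif01 /mrestr setTI lebesgue_measure_itv/= lte_fin ltr01 sube0.
Qed.

HB.instance Definition _ := Measure_isProbability.Build _ _ _ unif01
  unif01_setT.

(** The pushforward under the affine map, multiplied by [b], agrees with Lebesgue measure on
    half-open intervals, hence everywhere by uniqueness. *)
Lemma lebesgue_measure_affine (b s : R) (A : set RR) : 0 < b -> measurable A ->
  leb ((fun x => b * x + s) @^-1` A) = (b^-1%:E * leb A)%E.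
Proof.
move=> b0 mA.
pose f : RR -> RR := fun x => b * x + s.
have mf : measurable_fun [set: RR] f.
  by apply: (measurable_funD) => //; exact: (measurable_funM).
pose mu : {measure set RR -> \bar R} :=
  mscale (NngNum (ltW b0)) (pushforward leb f).
suff : leb A = mu mf A.
  rewrite /mu/= /mscale/= /pushforward/= => ->.
  by rewrite muleA -EFinM mulVf ?gt_eqF// mul1e.
apply: lebesgue_measure_unique => // X [[u v] _ <-]/=.
rewrite /mscale/= /pushforward/=.
have -> : (fun x : R => b * x + s) @^-1` `]u, v] =
    `](u - s) / b, (v - s) / b]%classic.
  apply/seteqP; split=> x /=; rewrite !in_itv/= ltr_pdivrMr// ler_pdivlMr//;
  rewrite ltrBlDr lerBrDr [x * b]mulrC //.
rewrite !lebesgue_measure_itv/= !lte_fin ltr_pM2r ?invr_gt0// ltrD2r.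
case: ifPn => uv; last by rewrite mule0.
by rewrite -!EFinB -EFinM; congr EFin; field; rewrite gt_eqF.
Qed.

Definition periodic1 (G : set R) := forall x, G (x + 1) <-> G x.

Lemma periodic1_int (G : set R) (k : int) x : periodic1 G ->
  G (x + k%:~R) <-> G x.
Proof.
move=> pG; have pn y (n : nat) : G (y + n%:R) <-> G y.
  elim: n => [|n IH]; first by rewrite addr0.
  by rewrite -natr1 addrA -IH; exact: pG.
case: (intP k) => [|n|n]; first by rewrite addr0.
  exact: pn.
by rewrite -(pn (x + _) n.+1) mulrNz -addrA addNr addr0.
Qed.

(** An integer shift replaces [s] by its fractional part [f]; then [[f, f + 1[] is cut at 1 and the
    part beyond 1 is moved back onto [[0, f[]. *)
Lemma unif01_window (G : set RR) (s : R) : measurable G -> periodic1 G ->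
  leb (G `&` `[s, s + 1[) = unif01 G.
Proof.
move=> mG pG.
have shift (k : int) (a c : R) :
    leb (G `&` `[a + k%:~R, c + k%:~R[) = leb (G `&` `[a, c[).
  rewrite -[RHS](@mul1e R) -{1}[1]invr1 -[in RHS](_ : (fun x : R =>
    1 * x + k%:~R) @^-1` (G `&` `[a + k%:~R, c + k%:~R[) = G `&` `[a, c[).
    rewrite lebesgue_measure_affine ?invr1 ?mul1e//.
    by apply: measurableI.
  apply/seteqP; split=> x /=; rewrite !in_itv/= !mul1r lerD2r ltrD2r;
    by move=> [? ->]; split=> //; apply/(periodic1_int k x pG).
pose f := s - (Num.floor s)%:~R.
have f0 : 0 <= f by rewrite subr_ge0 Num.Theory.floor_le_tmp.
have f1 : f < 1.
  by rewrite ltrBlDl; have := floorD1_gt s; rewrite intrD.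
transitivity (leb (G `&` `[f, f + 1[)).
  by rewrite -[RHS](shift (Num.floor s)) [f + 1 + _]addrAC /f subrK.
have split3 (a b c : R) : a <= b -> b <= c ->
    leb (G `&` `[a, c[) = (leb (G `&` `[a, b[) + leb (G `&` `[b, c[))%E.
  move=> ab bc; rewrite -measureU/=; first last.
  - by apply/seteqP; split=> x //= -[[_]];
    rewrite !in_itv/= => /andP[_ xb] [_ /andP[]]; rewrite leNgt xb.
  - exact: measurableI.
  - exact: measurableI.
  - rewrite -setIUr; congr (leb (_ `&` _)); apply/seteqP; split => x /=.
      rewrite !in_itv/=; case: (ltP x b) => xb /andP[-> ->]; [by left|by right].
    rewrite !in_itv/=; case=> /andP[h1 h2]; rewrite ?h1 ?h2 ?andbT/=.
      exact: lt_le_trans h2 bc.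
    exact: le_trans ab h1.
rewrite (split3 f 1 (f + 1)) ?(ltW f1) ?lerDr// /unif01 /mrestr.
rewrite (split3 0 f 1) ?(ltW f1)// addeC; congr (_ + _)%E.
by have := shift 1 0 f; rewrite add0r.
Qed.

(** The map sends [[0, 1[] onto [[s, s + b[], which consists of [b] unit windows of equal mass; the
    contraction factor of the preimage cancels the [b]. *)
Lemma unif01_affine (G : set RR) (b : nat) (s : R) : (0 < b)%N ->
  measurable G -> periodic1 G ->
  unif01 ((fun x => b%:R * x + s) @^-1` G) = unif01 G.
Proof.
move=> b0 mG pG.
have b0R : 0 < b%:R :> R by rewrite ltr0n.
have long (k : nat) : leb (G `&` `[s, s + k%:R[) = (k%:R%:E * unif01 G)%E.
  elim: k => [|k IH].
    by rewrite addr0 set_itvco0 setI0 measure0 mul0e.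
  have -> : G `&` `[s, s + k.+1%:R[ =
      (G `&` `[s, s + k%:R[) `|` (G `&` `[s + k%:R, s + k%:R + 1[).
    rewrite -setIUr; congr (_ `&` _); apply/seteqP; split => x /=;
      rewrite -natr1.
      rewrite !in_itv/= addrA; case: (ltP x (s + k%:R)) => xb /andP[-> ->];
        [by left|by right].
    rewrite !in_itv/=; case=> /andP[h1 h2].
      by rewrite h1/= (lt_trans h2)// addrA ltrDl.
    by rewrite addrA h2 andbT (le_trans _ h1)// lerDl.
  rewrite measureU/=; first last.
  - by apply/seteqP; split=> x //= -[[_]];
    rewrite !in_itv/= => /andP[_ xb] [_ /andP[]]; rewrite leNgt xb.
  - exact: measurableI.
  - exact: measurableI.
  by rewrite IH unif01_window// -natr1 EFinD ge0_muleDl ?lee_fin// mul1e.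
rewrite {1}/unif01 /mrestr.
have -> : (fun x => b%:R * x + s) @^-1` G `&` `[0, 1[ =
    (fun x => b%:R * x + s) @^-1` (G `&` `[s, s + b%:R[).
  apply/seteqP; split=> x /=; rewrite !in_itv/= => -[Gx].
    move=> /andP[h1 h2]; split => //; apply/andP; split; last nra.
    by rewrite lerDr mulr_ge0// ltW.
  rewrite lerDr pmulr_rge0// addrC ltrD2l => /andP[-> h].
  by split; [rewrite addrC|rewrite -(ltr_pM2l b0R) mulr1].
rewrite lebesgue_measure_affine//; last exact: measurableI.
by rewrite long muleA -EFinM mulVf ?gt_eqF// mul1e.
Qed.

(** The lift to the line of the open arc of radius [r] about [c] in the circle. *)
Definition periodic_itv (c r : R) : set R :=
  [set y | exists z : int, `|y - c - z%:~R| < r].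

Lemma periodic_itvP c r : periodic1 (periodic_itv c r).
Proof.
move=> x; split=> -[z hz].
  by exists (z - 1); rewrite intrB;
    have -> : x - c - (z%:~R - 1) = x + 1 - c - z%:~R by ring.
by exists (z + 1); rewrite intrD; have -> : x + 1 - c - (z%:~R + 1) =
  x - c - z%:~R by ring.
Qed.

Lemma measurable_periodic_itv c r : measurable (periodic_itv c r : set RR).
Proof.
rewrite (_ : periodic_itv c r =
    \bigcup_(z : int) `]c + z%:~R - r, c + z%:~R + r[%classic); last first.
  apply/seteqP; split=> y.
    move=> [z hz]; exists z => //=; rewrite in_itv/=.
    by move: hz; rewrite ltr_norml => /andP[h1 h2]; apply/andP; split; lra.
  move=> [z _ /=]; rewrite in_itv/= => /andP[h1 h2]; exists z.
  by rewrite ltr_norml; apply/andP; split; lra.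
by apply: countable_bigcupT_measurable => // z; exact: measurable_itv.
Qed.

(** Seen through the unit window centred at [c], only the translate [z = 0] is visible, because [r]
    is at most one half. *)
Lemma unif01_periodic_itv c r : 0 <= r -> r <= 2^-1 ->
  unif01 (periodic_itv c r) = (2 * r)%:E.
Proof.
move=> r0 r1.
rewrite -(unif01_window (c - 2^-1) (measurable_periodic_itv _ _) (@periodic_itvP
  c r)).
have -> : periodic_itv c r `&` `[c - 2^-1, c - 2^-1 + 1[ =
    `]c - r, c + r[%classic.
  apply/seteqP; split=> y /=; rewrite !in_itv/=.
    move=> [[z]]; rewrite ltr_norml => /andP[h1 h2] /andP[h3 h4].
    have z0 : z = 0.
      have : (-1 < z)%R by rewrite -(ltr_int R) mulrNz; lra.
      have : (z < 1)%R by rewrite -(ltr_int R); lra.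
      by lia.
    by move: h1 h2; rewrite z0 mulr0z => h1 h2; apply/andP; split; lra.
  move=> /andP[h1 h2]; split.
    by exists 0; rewrite mulr0z ltr_norml; apply/andP; split; lra.
  by apply/andP; split; lra.
rewrite lebesgue_measure_itv/= lte_fin.
case: ifPn => h; first by rewrite -EFinB; congr EFin; ring.
by congr EFin; move: h; rewrite -leNgt => h; lra.
Qed.

End UnitInterval.

(** * Uniform probability on the cube and Fubini in any coordinate *)

Section TorusProbability.
Context (R : realType).
Local Notation RR := (measurableTypeR R).
Local Notation T k := (k.-tuple RR).

Definition cons_tuple k (u : RR * T k) : T k.+1 :=
  [the k.+1.-tuple RR of u.1 :: u.2].

Lemma measurable_cons_tuple k : measurable_fun setT (@cons_tuple k).
Proof. exact: measurable_cons. Qed.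

HB.instance Definition _ k :=
  @isMeasurableFun.Build _ _ _ _ (@cons_tuple k) (@measurable_cons_tuple k).

(** Follows the recursion of [lebesgue_tuple], so that the two compare by induction, but carries the
    structure of a probability measure at every stage. *)
Fixpoint cube_prob k : probability (T k) R :=
  match k with
  | 0 => dirac [tuple]
  | k'.+1 => distribution (@unif01 R \x @cube_prob k')%E (@cons_tuple k')
  end.

Lemma cube_prob_cons k (A : set (T k.+1)) :
  cube_prob k.+1 A =
  (\int[@unif01 R]_x cube_prob k [set t | A (cons_tuple (x, t))])%E.
Proof.
rewrite /= /distribution /pushforward /product_measure1.
apply: eq_integral => x _ /=; congr (cube_prob k _).
by apply/seteqP; split=> t /=; rewrite xsectionE.
Qed.

Lemma ge0_integral_unif01 (f : RR -> \bar R) : measurable_fun setT f ->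
  (forall x, 0 <= f x)%E ->
  (\int[@unif01 R]_x f x = \int[@lebesgue_measure R]_(x in `[0%R, 1%R[) f x)%E.
Proof.
move=> mf f0.
rewrite (@ge0_negligible_integral _ _ _ _ _ (~` (`[(0 : R), 1[%classic :
  set RR)))//; last 2 first.
  by apply: measurableC; exact: measurable_itv.
  by rewrite /= /unif01 /mrestr setICl measure0.
rewrite setTD setCK; apply: eq_measure_integral => A mA A01.
by rewrite /= /unif01 /mrestr setIidl.
Qed.

Definition half_open_cube k : set (T k) :=
  [set t | forall i, 0 <= tnth t i < 1].

Lemma measurable_cons_section k (A : set (T k.+1)) x : measurable A ->
  measurable [set t | A (cons_tuple (x, t))].
Proof.
move=> mA; rewrite -[X in measurable X]setTI.
by apply: (measurable_cons (measurable_cst x) (@measurable_id _ _ setT)).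
Qed.

Lemma measurable_cube_prob_cons k (A : set (T k.+1)) : measurable A ->
  measurable_fun [set: RR]
    (fun x => cube_prob k [set t | A (cons_tuple (x, t))]).
Proof.
move=> mA.
have mB : measurable (@cons_tuple k @^-1` A).
  by rewrite -[X in measurable X]setTI; exact: measurable_cons_tuple.
have := measurable_fun_xsection (cube_prob k) mB.
congr (measurable_fun _ _); apply/funext => x /=; congr (cube_prob k _).
by apply/seteqP; split=> t /=; rewrite xsectionE.
Qed.

Lemma lebesgue_tuple_cube k (A : set (T k)) : measurable A ->
  lebesgue_tuple (A `&` @half_open_cube k) = cube_prob k A.
Proof.
elim: k A => [|k IH] A mA.
  rewrite /=; congr (dirac _ _); apply/seteqP; split=> t /=; first by case.
  by move=> At; split=> // -[].
rewrite cube_prob_cons.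
rewrite ge0_integral_unif01//; last exact: measurable_cube_prob_cons.
rewrite [RHS]integral_mkcond /= /pushforward /product_measure1.
apply: eq_integral => x _ /=; rewrite patchE.
(* [lebesgue_tuple] is a bare set function, so its value at the empty set is taken from the
   induction hypothesis. It serves the sections over points outside [[0, 1[]. *)
have lt0 : lebesgue_tuple (set0 : set (T k)) = 0%E.
  by have := IH set0 measurable0; rewrite set0I measure0.
case: ifPn => [|/negP x01].
  rewrite inE/= in_itv/= => x01; rewrite -IH;
    last exact: measurable_cons_section.
  congr (lebesgue_tuple _); apply/seteqP; split=> t /=; rewrite xsectionE /=.
    move=> [At ct]; split => // i.
    by have := ct (lift ord0 i); rewrite (tnth_nth 0) /= -tnth_nth.
  move=> [At ct]; split=> // i; case: (unliftP ord0 i) => [j|] ->.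
    by rewrite tnthS.
  by rewrite tnth0.
rewrite -[RHS]lt0; congr (lebesgue_tuple _).
apply/seteqP; split=> t //=; rewrite xsectionE /= => -[_ /(_ ord0)].
rewrite (tnth_nth 0) /= => h; apply: x01.
by rewrite inE/= in_itv.
Qed.

Definition set_coord k (c : 'I_k) (t : T k) (x : RR) : T k :=
  [tuple if i == c then x else tnth t i | i < k].

Lemma tnth_set_coord k (c : 'I_k) t x i :
  tnth (set_coord c t x) i = if i == c then x else tnth t i.
Proof. by rewrite tnth_mktuple. Qed.

Lemma measurable_set_coord k (c : 'I_k) :
  measurable_fun setT (fun u : T k * RR => set_coord c u.1 u.2).
Proof.
apply/measurable_fun_tnthP => i; rewrite /comp.
under eq_fun do rewrite tnth_set_coord.
case: eqP => _; first exact: measurable_snd.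
by apply: (measurableT_comp (measurable_tnth i)); exact: measurable_fst.
Qed.

Lemma measurable_coord_section k (c : 'I_k) (A : set (T k)) : measurable A ->
  measurable_fun [set: T k] (fun t => @unif01 R [set x | A (set_coord c t x)]).
Proof.
move=> mA.
have mB : measurable ((fun u : T k * RR => set_coord c u.1 u.2) @^-1` A).
  by rewrite -[X in measurable X]setTI; exact: measurable_set_coord.
have := measurable_fun_xsection (@unif01 R) mB.
congr (measurable_fun _ _); apply/funext => x /=; congr (unif01 _).
by apply/seteqP; split=> t /=; rewrite xsectionE.
Qed.

(** Fubini with coordinate [c] integrated innermost. The outer integral still runs over all
    coordinates, which is harmless: the integrand ignores coordinate [c], and that coordinate has
    total mass 1. *)
Lemma cube_prob_coord k (c : 'I_k) (A : set (T k)) : measurable A ->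
  cube_prob k A =
  (\int[cube_prob k]_t @unif01 R [set x | A (set_coord c t x)])%E.
Proof.
elim: k c A => [[]//|k IH] c A mA.
have mg := measurable_coord_section c mA.
set L := cube_prob k.+1 A.
rewrite [cube_prob k.+1]/= ge0_integral_distribution//.
rewrite fubini_tonelli1//=; last first.
  exact: (measurableT_comp mg (@measurable_cons_tuple k)).
rewrite /fubini_F/=.
case: (unliftP ord0 c) mg => [c'|] -> _.
  rewrite /L cube_prob_cons; apply: eq_integral => x _.
  rewrite (IH c'); last exact: measurable_cons_section.
  apply: eq_integral => t _; congr (unif01 _).
  suff sc y : set_coord (lift ord0 c') (cons_tuple (x, t)) y =
      cons_tuple (x, set_coord c' t y).
    by apply/seteqP; split=> y /=; rewrite sc.
  apply: eq_from_tnth => i; rewrite tnth_set_coord.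
  case: (unliftP ord0 i) => [j|] ->; last by rewrite !tnth0.
  by rewrite (inj_eq lift_inj) !tnthS tnth_set_coord.
have sc x y (t : T k) :
    set_coord ord0 (cons_tuple (x, t)) y = cons_tuple (y, t).
  apply: eq_from_tnth => i; rewrite tnth_set_coord;
    case: (unliftP ord0 i) => [j|] ->.
    by rewrite !tnthS.
  by rewrite !tnth0.
(* For the first coordinate the integral over it on the right is that of the constant [C]; what
   remains is to exchange the order of integration. *)
pose C := (\int[cube_prob k]_t @unif01 R [set y | A (cons_tuple (y, t))])%E.
transitivity C; last first.
  transitivity (\int[@unif01 R]_x (cst C x))%E.
    by rewrite integral_cst//= [unif01 _]probability_setT mule1.
  apply: eq_integral => x _; apply: eq_integral => t _ /=.
  by congr (unif01 _); apply/seteqP; split=> y /=; rewrite sc.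
rewrite /L /= /distribution /pushforward.
have mB : measurable (@cons_tuple k @^-1` A).
  by rewrite -[X in measurable X]setTI; exact: measurable_cons_tuple.
(* The two iterated integrals define measures that agree on rectangles, hence on all measurable
   sets. *)
transitivity ((@unif01 R \x^ cube_prob k)%E (@cons_tuple k @^-1` A)).
  by apply: product_measure_unique => // A1 A2 mA1 mA2;
    exact: product_measure2E.
apply: eq_integral => t _ /=; congr (unif01 _).
by apply/seteqP; split=> y /=; rewrite ysectionE.
Qed.
End TorusProbability.

(** * Measure-preserving coordinate changes and peeling off conditions *)

Section CoordinateChanges.
Context (R : realType).
Local Notation RR := (measurableTypeR R).
Local Notation T k := (k.-tuple RR).

(** With [S] equal to [Prop] this also covers sets, which are then cylinders in direction [c]. *)
Definition coord_indep k (c : 'I_k) (S : Type) (f : T k -> S) : Prop :=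
  forall t x, f (set_coord c t x) = f t.

Lemma measurable_preimageT d d' (X : measurableType d) (Y : measurableType d')
  (f : X -> Y) (A : set Y) : measurable_fun setT f -> measurable A ->
  measurable (f @^-1` A).
Proof. by move=> mf mA; rewrite -[X in measurable X]setTI; exact: mf. Qed.

Lemma measurable_update_coord k (c : 'I_k) (f : T k -> RR) :
  measurable_fun setT f -> measurable_fun setT (fun t => set_coord c t (f t)).
Proof.
move=> mf.
apply: (measurableT_comp (@measurable_set_coord R k c) (g := fun t => (t,
  f t))).
exact: measurable_fun_pair.
Qed.

Lemma measurable_affine_coord k (c : 'I_k) (b : R) (s : T k -> RR) :
  measurable_fun setT s ->
  measurable_fun setT (fun t : T k => b * tnth t c + s t : RR).
Proof.
move=> ms; apply: measurable_funD => //; apply: measurable_funM => //.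
exact: measurable_tnth.
Qed.

Lemma set_coordK k (c : 'I_k) (t : T k) x y :
  set_coord c (set_coord c t x) y = set_coord c t y.
Proof. by apply: eq_from_tnth => i; rewrite !tnth_set_coord; case: eqP. Qed.

Lemma set_coordC k (c c' : 'I_k) (t : T k) x y : c != c' ->
  set_coord c (set_coord c' t x) y = set_coord c' (set_coord c t y) x.
Proof.
move=> cc; apply: eq_from_tnth => i; rewrite !tnth_set_coord.
by case: (eqVneq i c) => // ->; rewrite (negbTE cc).
Qed.

(** On each line in direction [c] the shift [s] is constant, so [unif01_affine] applies fibre by
    fibre. *)
Lemma cube_prob_affine_coord k (c : 'I_k) (b : nat) (s : T k -> RR)
    (A : set (T k)) :
  (0 < b)%N -> measurable_fun setT s -> coord_indep c s -> measurable A ->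
  (forall t, periodic1 [set x | A (set_coord c t x)]) ->
  cube_prob R k [set t | A (set_coord c t (b%:R * tnth t c + s t))] =
  cube_prob R k A.
Proof.
move=> b0 ms sc mA pA.
rewrite (cube_prob_coord c mA) (cube_prob_coord c); last first.
  apply: (measurable_preimageT (f := fun t =>
    set_coord c t (b%:R * tnth t c + s t))) => //.
  by apply: measurable_update_coord; exact: measurable_affine_coord.
apply: eq_integral => t _ /=.
have mAt : measurable [set x | A (set_coord c t x)].
  apply: (measurable_preimageT (f := set_coord c t)) => //.
  apply: (measurableT_comp (@measurable_set_coord R k c) (g := fun x => (t,
    x))).
  exact: measurable_fun_pair.
rewrite -(unif01_affine (s t) b0 mAt (pA t)); congr (unif01 _).
by apply/seteqP; split=> x /=; rewrite set_coordK sc tnth_set_coord eqxx.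
Qed.

(** A line in direction [c] lies in [A] entirely or not at all, and in either case the condition [G]
    has mass [unif01 G] on it: this is independence. *)
Lemma cube_prob_peel k (c : 'I_k) (b : nat) (s : T k -> RR) (A : set (T k))
    (G : set RR) :
  (0 < b)%N -> measurable_fun setT s -> coord_indep c s ->
  measurable A -> coord_indep c A -> measurable G -> periodic1 G ->
  cube_prob R k (A `&` [set t | G (b%:R * tnth t c + s t)]) =
  (cube_prob R k A * unif01 G)%E.
Proof.
move=> b0 ms sc mA cA mG pG.
rewrite (cube_prob_coord c); last first.
  apply: measurableI => //; apply: measurable_preimageT => //.
  exact: measurable_affine_coord.
transitivity (\int[cube_prob R k]_t ((\1_A t)%:E * unif01 G))%E.
  apply: eq_integral => t _; rewrite indicE.
  have [|/negP] := boolP (t \in A); rewrite inE => At.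
    rewrite mul1e -(unif01_affine (s t) b0 mG pG); congr (unif01 _).
    apply/seteqP; split=> x /=; rewrite cA sc tnth_set_coord eqxx.
      by case.
    by [].
  rewrite mul0e -[RHS](measure0 (@unif01 R)); congr (unif01 _).
  by apply/seteqP; split=> x //=; rewrite cA => -[].
rewrite ge0_integralZr//.
- by rewrite integral_indic// setIT.
- exact/measurable_EFinP.
Qed.

(* With [u = a x + b y] and [v = c x + d y], replacing [x] by [x - b y] and then
   [y] by [a y] makes [u] depend on [x] only, and [v] on [y] with coefficient
   [a d - b c]; both replacements preserve the measure of periodic sets. *)
Lemma cube_prob_peel2 k (c0 c1 : 'I_k) (a b c d : nat) (s0 s1 : T k -> RR)
    (A : set (T k)) (G H : set RR) :
  c0 != c1 -> (b * c < a * d)%N ->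
  measurable_fun setT s0 -> coord_indep c0 s0 -> coord_indep c1 s0 ->
  measurable_fun setT s1 -> coord_indep c0 s1 -> coord_indep c1 s1 ->
  measurable A -> coord_indep c0 A -> coord_indep c1 A ->
  measurable G -> periodic1 G -> measurable H -> periodic1 H ->
  cube_prob R k (A `&`
    [set t | G (a%:R * tnth t c0 + b%:R * tnth t c1 + s0 t) /\
             H (c%:R * tnth t c0 + d%:R * tnth t c1 + s1 t)]) =
  (cube_prob R k A * unif01 G * unif01 H)%E.
Proof.
move=> c01 det ms0 s00 s01 ms1 s10 s11 mA A0 A1 mG pG mH pH.
have a0 : (0 < a)%N by case: a det.
set B := A `&` _.
have mform (e f : nat) s : measurable_fun setT s ->
    measurable_fun setT (fun t : T k =>
      e%:R * tnth t c0 + f%:R * tnth t c1 + s t : RR).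
  move=> ms; under eq_fun do rewrite -addrA.
  by do 2 apply: measurable_affine_coord.
have mB : measurable B.
  apply: measurableI => //.
  by apply: measurableI; apply: measurable_preimageT => //; exact: mform.
(* Since the coefficients are integers, raising a coordinate by 1 shifts the arguments of [G] and
   [H] by integers. *)
have perB c' t : c' \in [:: c0; c1] -> periodic1 [set x | B (set_coord c' t x)].
  have pers (e : nat) (K : set R) x y : periodic1 K ->
      K (e%:R * (x + 1) + y) <-> K (e%:R * x + y).
    move=> pK; rewrite -(periodic1_int (Posz e) (e%:R * x + y) pK) -pmulrn.
    by rewrite mulrDr mulr1 addrAC.
  have pers' (e : nat) (K : set R) x y z : periodic1 K ->
      K (y + e%:R * (x + 1) + z) <-> K (y + e%:R * x + z).
    by move=> pK; rewrite -!addrA !(addrCA y); exact: pers.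
  rewrite !inE => /orP[] /eqP -> x; rewrite /B /= !tnth_set_coord !eqxx.
    by rewrite !A0 !s00 !s10 eq_sym (negbTE c01) -!addrA !pers.
  by rewrite !A1 !s01 !s11 (negbTE c01) !pers'.
have [i0 i1] : c0 \in [:: c0; c1] /\ c1 \in [:: c0; c1].
  by rewrite !inE !eqxx orbT.
have := @cube_prob_affine_coord k c1 a (cst 0) B a0 (measurable_cst _)
  (fun t x => erefl) mB (fun t => perB c1 t i1).
move=> <-; set B' := [set t | _].
have mB' : measurable B'.
  apply: (measurable_preimageT (f := fun t =>
    set_coord c1 t (a%:R * tnth t c1 + cst 0 t))) => //.
  by apply: measurable_update_coord; exact: measurable_affine_coord.
have perB' t : periodic1 [set x | B' (set_coord c0 t x)].
  move=> x; rewrite /B' /= !tnth_set_coord eq_sym (negbTE c01).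
  by rewrite !(set_coordC _ _ _ (_ : c1 != c0)) 1?eq_sym//; exact: perB.
have ms : measurable_fun setT (fun t : T k => - b%:R * tnth t c1 : RR).
  by apply: measurable_funM => //; exact: measurable_tnth.
have := @cube_prob_affine_coord k c0 1 (fun t =>
  - b%:R * tnth t c1) B' isT ms _ mB' perB'.
move=> <-; last by move=> t x; rewrite tnth_set_coord eq_sym (negbTE c01).
have ms0' : measurable_fun setT (fun t : T k => 0 * tnth t c1 + s0 t : RR).
  exact: measurable_affine_coord.
(* After both changes [G] no longer involves [c1]. Hence [G] is peeled off [A] along [c0], and then
   [H] off their intersection along [c1]. *)
rewrite -(@cube_prob_peel k c0 a s0 A G)//.
have mAG : measurable (A `&` [set t | G (a%:R * tnth t c0 + s0 t)]).
  by apply: measurableI => //; apply: measurable_preimageT => //;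
    exact: measurable_affine_coord.
have ms1' : measurable_fun setT (fun t : T k => c%:R * tnth t c0 + s1 t : RR).
  exact: measurable_affine_coord.
rewrite -(@cube_prob_peel k c1 (a * d - b * c) (fun t =>
  c%:R * tnth t c0 + s1 t))//.
- congr (cube_prob R k _).
  apply/seteqP; split=> t; rewrite /B' /B /= !tnth_set_coord !eqxx;
    rewrite ![c1 == c0]eq_sym (negbTE c01) A1 A0 s01 s00 s11 s10 addr0 mul1r;
    rewrite natrB ?(ltnW det)// !natrM.
    move=> [At [Gt Ht]]; split; first split=> //.
      by move: Gt; congr G; ring.
    by move: Ht; congr H; ring.
  move=> [[At Gt] Ht]; split=> //; split.
    by move: Gt; congr G; ring.
  by move: Ht; congr H; ring.
- by rewrite subn_gt0.
- by move=> t x; rewrite tnth_set_coord (negbTE c01) s11.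
- by move=> t x; rewrite /setI /= A1 tnth_set_coord (negbTE c01) s01.
Qed.
End CoordinateChanges.

(** * Pairs of linear forms on matrices: measure and independence *)

Section LinearForms.
Context (R : realType) (n m : nat).
Local Notation RR := (measurableTypeR R).
Local Notation T := ((n * m).-tuple RR).
Implicit Types (v w : 'I_n -> nat) (x y : 'rV[R]_m) (t : T).

Lemma mxvec_index_inj (i i' : 'I_n) (j j' : 'I_m) :
  mxvec_index i j = mxvec_index i' j' -> i = i' /\ j = j'.
Proof.
have [g gK _] := curry_mxvec_bij n m.
by move=> /(congr1 g); rewrite (gK (i, j) isT) (gK (i', j') isT) => -[].
Qed.

Lemma eq_mxvec_index (i i' : 'I_n) (j j' : 'I_m) :
  (mxvec_index i j == mxvec_index i' j') = (i == i') && (j == j').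
Proof.
apply/eqP/andP; first by move=> /mxvec_index_inj[-> ->].
by case=> /eqP -> /eqP ->.
Qed.

(** Entry [j] of the row [v X], restricted to the rows in [I]; removing from [I] the rows being
    varied leaves a remainder independent of them. *)
Definition partial_form (I : pred 'I_n) v (j : 'I_m) t : RR :=
  \sum_(i | I i) (v i)%:R * tnth t (mxvec_index i j).

Lemma measurable_partial_form I v j : measurable_fun setT (partial_form I v j).
Proof.
rewrite /partial_form; under eq_fun do rewrite big_mkcond/=.
apply: (@measurable_sum _ T R setT _ _ (fun i t =>
  if I i then (v i)%:R * tnth t (mxvec_index i j) else 0)) => i.
case: (I i); last exact: measurable_cst.
by apply: measurable_funM => //; exact: measurable_tnth.
Qed.

Lemma partial_form_indep I v j i' j' : (j' != j) || ~~ I i' ->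
  coord_indep (mxvec_index i' j') (partial_form I v j).
Proof.
move=> h t x; apply: eq_bigr => i Ii; rewrite tnth_set_coord eq_mxvec_index.
case: eqP => //= ii; case: eqP => //= jj.
by move: h; rewrite -ii -jj Ii eqxx.
Qed.

Definition torus_ball x r : set 'rV[R]_m :=
  [set y | forall j, periodic_itv (x 0 j) r (y 0 j)].

Definition form_row v t : 'rV[R]_m := \row_j partial_form predT v j t.

Definition form_event v x r : set T := form_row v @^-1` torus_ball x r.

(** A ball in the maximum norm is a product of arcs, so its preimage is an intersection of slabs,
    each involving a single column of the matrix. *)
Let slab v x r j : set T :=
  [set t | periodic_itv (x 0 j) r (partial_form predT v j t)].

Let measurable_slab v x r j : measurable (slab v x r j).
Proof.
apply: measurable_preimageT; first exact: measurable_partial_form.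
exact: measurable_periodic_itv.
Qed.

Let slab_indep v x r j i' j' : j' != j ->
  coord_indep (mxvec_index i' j') (slab v x r j).
Proof. by move=> jj t z; rewrite /slab /= partial_form_indep ?jj. Qed.

Let form_eventE v x r : form_event v x r = [set t | forall j, slab v x r j t].
Proof.
by apply/seteqP; split=> t /= h j; have := h j; rewrite /slab /= mxE.
Qed.

Let on_cons (F : 'I_m -> set T) j (js : seq 'I_m) :
  [set t | forall k, k \in j :: js -> F k t] =
  [set t | forall k, k \in js -> F k t] `&` F j.
Proof.
apply/seteqP; split=> t /=.
  by move=> h; split=> [k kj|]; apply: h; rewrite inE ?eqxx// kj orbT.
by move=> [h hj] k; rewrite inE => /orP[/eqP ->//|]; exact: h.
Qed.

Let measurable_on (F : 'I_m -> set T) (js : seq 'I_m) :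
  (forall j, measurable (F j)) ->
  measurable [set t | forall k, k \in js -> F k t].
Proof.
move=> mF; elim: js => [|j js IH]; last by rewrite on_cons; exact: measurableI.
by rewrite (_ : [set _ | _] = setT)//; apply/seteqP; split.
Qed.

Let on_indep (F : 'I_m -> set T) (js : seq 'I_m) c :
  (forall j, j \in js -> coord_indep c (F j)) ->
  coord_indep c [set t | forall k, k \in js -> F k t].
Proof.
move=> h t z; apply/propext; split=> /= H k kj; have := H k kj;
  by rewrite (h k kj t z).
Qed.

Let on_enum (F : 'I_m -> set T) :
  [set t | forall j, F j t] = [set t | forall k : 'I_m,
    k \in enum (@predT 'I_m) -> F k t].
Proof.
by apply/seteqP; split=> t /= h j => [_|]; apply: h; rewrite mem_enum.
Qed.

Lemma measurable_form_event v x r : measurable (form_event v x r).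
Proof. by rewrite form_eventE on_enum; exact: measurable_on. Qed.

(** Columns are peeled off one at a time: entry [(i0, j)] occurs in slab [j] with a positive
    coefficient and in no other slab. *)
Lemma cube_prob_form_event v x r i0 : (0 < v i0)%N -> 0 <= r -> r <= 2^-1 ->
  cube_prob R (n * m) (form_event v x r) = ((2 * r) ^+ m)%:E.
Proof.
move=> v0 r0 r1; rewrite form_eventE on_enum.
have -> : (2 * r) ^+ m = (2 * r) ^+ size (enum (@predT 'I_m)) by rewrite -cardE
  card_ord.
elim: (enum (@predT 'I_m)) (enum_uniq (@predT 'I_m)) => [_|j js IH /=
  /andP[jjs ujs]].
  rewrite expr0 (_ : [set _ | _] = setT) ?probability_setT//.
  by apply/seteqP; split.
have split1 t : partial_form predT v j t =
  (v i0)%:R * tnth t (mxvec_index i0 j) +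
    partial_form [pred i | i != i0] v j t by rewrite /partial_form (bigD1 i0).
rewrite on_cons (_ : slab v x r j = [set t | periodic_itv (x 0 j) r
    ((v i0)%:R * tnth t (mxvec_index i0 j) +
     partial_form [pred i | i != i0] v j t)]); last first.
  by apply/seteqP; split=> t; rewrite /slab /= split1.
rewrite cube_prob_peel//.
- by rewrite IH// unif01_periodic_itv// -EFinM exprSr.
- exact: measurable_partial_form.
- by apply: partial_form_indep; rewrite /= !eqxx.
- exact: measurable_on.
- by apply: on_indep => k kjs; apply: slab_indep; apply: contraNneq jjs => ->.
- exact: measurable_periodic_itv.
- exact: periodic_itvP.
Qed.

(** In each column, the entries in rows [i0] and [i1] meet the two forms with a nonzero minor, so
    [cube_prob_peel2] removes both slabs of that column at once. The opposite sign of the minor is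
    covered by exchanging [i0] and [i1]. *)
Lemma cube_prob_form_event2 v w x y r s i0 i1 :
  (v i1 * w i0 < v i0 * w i1)%N ->
  0 <= r -> r <= 2^-1 -> 0 <= s -> s <= 2^-1 ->
  cube_prob R (n * m) (form_event v x r `&` form_event w y s) =
  ((2 * r) ^+ m * (2 * s) ^+ m)%:E.
Proof.
move=> det r0 r1 s0 s1.
have i01 : i0 != i1 by apply: contraTneq det => ->; rewrite ltnn.
pose F j := slab v x r j `&` slab w y s j.
have mF j : measurable (F j) by exact: measurableI.
rewrite (_ : _ `&` _ = [set t | forall j, F j t]); last first.
  rewrite !form_eventE; apply/seteqP; split=> t /=.
    by move=> [h1 h2] j; split; [exact: h1|exact: h2].
  by move=> h; split=> j; have [] := h j.
rewrite on_enum -exprMn.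
rewrite -[in RHS](_ : size (enum (@predT 'I_m)) = m);
  last by rewrite -cardE card_ord.
elim: (enum (@predT 'I_m)) (enum_uniq (@predT 'I_m)) => [_|j js IH /=
  /andP[jjs ujs]].
  rewrite expr0 (_ : [set _ | _] = setT) ?probability_setT//.
  by apply/seteqP; split.
pose J := [pred i | (i != i0) && (i != i1)].
have split u t : partial_form predT u j t =
    (u i0)%:R * tnth t (mxvec_index i0 j) +
     (u i1)%:R * tnth t (mxvec_index i1 j) +
    partial_form J u j t.
  rewrite /partial_form (bigD1 i0)//= (bigD1 i1)/=; last by rewrite eq_sym.
  by rewrite addrA.
rewrite on_cons (_ : F j = [set t | periodic_itv (x 0 j) r
    ((v i0)%:R * tnth t (mxvec_index i0 j) +
     (v i1)%:R * tnth t (mxvec_index i1 j) +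
     partial_form J v j t) /\ periodic_itv (y 0 j) s
    ((w i0)%:R * tnth t (mxvec_index i0 j) +
     (w i1)%:R * tnth t (mxvec_index i1 j) +
     partial_form J w j t)]); last first.
  by apply/seteqP; split=> t; rewrite /F /slab /= !split.
have indJ u : coord_indep (mxvec_index i0 j) (partial_form J u j) /\
    coord_indep (mxvec_index i1 j) (partial_form J u j).
  by split; apply: partial_form_indep; rewrite /J /= !eqxx ?andbF.
have indF i : coord_indep (mxvec_index i j) [set t | forall k, k \in js ->
  F k t].
  apply: on_indep => k kjs t z; have jk : j != k by apply: contraNneq jjs => ->.
  by rewrite /F /setI /= !slab_indep.
have mJ u := measurable_partial_form J u j.
rewrite cube_prob_peel2//; first last.
- exact: periodic_itvP.
- exact: measurable_periodic_itv.
- exact: periodic_itvP.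
- exact: measurable_periodic_itv.
- exact: measurable_on.
- by case: (indJ w).
- by case: (indJ w).
- by case: (indJ v).
- by case: (indJ v).
- by rewrite eq_mxvec_index (negbTE i01).
by rewrite IH// !unif01_periodic_itv// -!EFinM exprSr mulrA.
Qed.

End LinearForms.

(** * Approximation sets as events, and their measurability *)

Section ApproximationEvents.
Context (R : realType) (n m : nat).
Hypothesis m0 : (0 < m)%N.
Local Notation RR := (measurableTypeR R).
Local Notation T := ((n * m).-tuple RR).
Variable P : nat -> {fset 'rV[R]_m}.
Hypothesis hP : torus_family P.

Definition primitive_part (q : 'rV[nat]_n) (i : 'I_n) : nat :=
  (q 0%R i %/ gcdv q)%N.

Lemma gcdv_dvd (q : 'rV[nat]_n) i : (gcdv q %| q 0%R i)%N.
Proof. exact: (biggcdn_inf i). Qed.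

Lemma primitive_partK (q : 'rV[nat]_n) i :
  (gcdv q * primitive_part q i)%N = q 0%R i.
Proof. by rewrite mulnC divnK// gcdv_dvd. Qed.

Lemma gcdv_gt0 (q : 'rV[nat]_n) : (0 < gcdv q)%N = (q != 0).
Proof.
apply/idP/idP => [|q0]; last first.
  rewrite lt0n; apply: contra q0 => /eqP g0; apply/eqP/rowP => i.
  by rewrite -(primitive_partK q i) g0 mul0n mxE.
apply: contraTneq => ->; rewrite -eqn0Ngt; apply/eqP.
by rewrite /gcdv big1// => i _; rewrite mxE.
Qed.

Lemma row_norm_lt (x : 'rV[R]_m) r :
  `|x| < r <-> forall j, `|x 0 j| < r.
Proof.
rewrite (_ : `|x| = mx_norm x)// mx_normrE; split=> [h j|h].
  apply: le_lt_trans h.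
  exact: (@le_bigmax _ _ _ 0 (fun ij : 'I_1 * 'I_m => `|x ij.1 ij.2|) (0, j)).
apply: bigmax_lt; first exact: le_lt_trans (h (Ordinal m0)).
by move=> [i j] _ /=; rewrite (ord1 i).
Qed.

Lemma form_rowE (q : 'rV[nat]_n) (t : T) :
  natmx R q *m mx_of_tuple t = form_row (q 0) t.
Proof.
apply/rowP => j; rewrite !mxE; apply: eq_bigr => i _.
by rewrite /mx_of_tuple !mxE.
Qed.

(** Division by [d = gcdv q] turns closeness of [q X] to [p] modulo [d] into closeness of [v X] to
    [p / d] modulo 1, with [v] the primitive part. *)
Lemma approx_set_fin (q : 'rV[nat]_n) (s : R) : q != 0 ->
  @mx_of_tuple R n m @^-1` approx_set P q s%:E =
  \bigcup_(p in [set` P (gcdv q)])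
    form_event (primitive_part q) ((gcdv q)%:R^-1 *: p) (s / (gcdv q)%:R).
Proof.
rewrite -gcdv_gt0 => d0; set d := gcdv q in d0 *.
have d0R : 0 < d%:R :> R by rewrite ltr0n.
have scale (t : T) (p : 'rV[R]_m) (z : int) j :
    (`|partial_form predT (primitive_part q) j t - (d%:R^-1 *: p) 0 j - z%:~R| <
       s / d%:R) =
    (`|form_row (q 0) t 0 j - (p 0 j + d%:R * z%:~R)| < s).
  rewrite ltr_pdivlMr// -[d%:R in X in X < _](gtr0_norm d0R) -normrM.
  congr (`|_| < _); rewrite !mxE mulrBl mulrBl opprD addrA mulr_suml.
  congr (_ - _ - _); last by rewrite mulrC.
    apply: eq_bigr => i _; rewrite -(primitive_partK q i) natrM; ring.
  by rewrite gtr0_norm// mulrAC mulVf ?gt_eqF// mul1r.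
apply/seteqP; split=> t /=.
  move=> [_ [p pP [z ->]]]; rewrite lte_fin form_rowE => /row_norm_lt h.
  exists p => // j; exists (z 0 j); rewrite mxE scale.
  by have := h j; rewrite !mxE.
move=> [p pP h].
have /choice[z hz] : forall j, exists z : int,
    `|form_row (q 0) t 0 j - (p 0 j + d%:R * z%:~R)| < s.
  by move=> j; have [z hz] := h j; exists z; rewrite -scale; rewrite mxE in hz.
exists (p + d%:R *: map_mx intr (\row_j z j)).
  by exists p => //; exists (\row_j z j).
rewrite lte_fin form_rowE; apply/row_norm_lt => j.
by have := hz j; rewrite !mxE.
Qed.

Lemma approx_set_pinfty (q : 'rV[nat]_n) : q != 0 ->
  approx_set P q +oo = setT :> set 'M[R]_(n, m).
Proof.
rewrite -gcdv_gt0 => /hP[/fset0Pn[p pP] _]; apply/seteqP; split=> // X _.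
exists p; last exact: ltry.
by exists p => //; exists 0; rewrite map_mx0 scaler0 addr0.
Qed.

Lemma measurable_approx (q : 'rV[nat]_n) r : q != 0 ->
  measurable (@mx_of_tuple R n m @^-1` approx_set P q r).
Proof.
move=> q0; case: r => [s| |].
- rewrite approx_set_fin//; apply: fin_bigcup_measurable => // p _.
  exact: measurable_form_event.
- by rewrite approx_set_pinfty// preimage_setT.
- rewrite (_ : approx_set P q -oo = set0) ?preimage_set0//.
  by apply/seteqP; split=> // X [p _].
Qed.

(** Only finitely many rows have a code below [k]. This writes [W] as a countable intersection of
    countable unions. *)
Lemma infinite_set_pickle (S : set 'rV[nat]_n) :
  infinite_set S <-> forall k, exists2 q, S q & (k <= choice.pickle q)%N.
Proof.
split=> [infS k|h].
  apply: contrapT => nS; apply: infS.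
  apply: (@sub_finite_set _ _ [set` pmap choice.unpickle (iota 0 k)]);
    last exact: finite_seq.
  move=> q Sq /=; rewrite mem_pmap; apply/mapP; exists (choice.pickle q);
    last by rewrite choice.pickleK.
  rewrite mem_iota /= add0n ltnNge; apply/negP => kq; apply: nS.
  by exists q.
move=> /finite_seqP[X SX].
have [q Sq] := h (\max_(x <- X) choice.pickle x).+1.
rewrite ltnNge => /negP; apply.
rewrite SX /= in Sq; exact: leq_bigmax_seq.
Qed.

Lemma measurable_W (psi : 'rV[nat]_n -> \bar R) :
  measurable (@mx_of_tuple R n m @^-1` W P psi).
Proof.
rewrite (_ : _ @^-1` _ = \bigcap_k \bigcup_(q in [set q : 'rV[nat]_n | (k <=
  choice.pickle q)%N])
    (if q == 0 then set0 else @mx_of_tuple R n m @^-1` approx_set P q (psi q))).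
  apply: bigcapT_measurable => k; rewrite bigcup_mkcond.
  apply: countable_bigcupT_measurable => // q.
  case: ifP => // _; case: eqVneq => // q0; exact: measurable_approx.
apply/seteqP; split=> t /=.
  move=> /infinite_set_pickle h k _; have [q [q0 hq] kq] := h k.
  by exists q => //; rewrite (negbTE q0).
move=> h; apply/infinite_set_pickle => k; have [q kq] := h k I.
by case: eqVneq => // q0 hq; exists q.
Qed.

Lemma torus_lebesgueE (A : set 'M[R]_(n, m)) :
  measurable (@mx_of_tuple R n m @^-1` A) ->
  torus_lebesgue A = cube_prob R (n * m) (@mx_of_tuple R n m @^-1` A).
Proof.
move=> mA; rewrite -lebesgue_tuple_cube// /torus_lebesgue;
  congr (lebesgue_tuple _).
rewrite preimage_setI; congr (_ `&` _); apply/seteqP; split=> t /=.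
  move=> h k; have [i j] := mxvec_indexP k; have := h i j.
  by rewrite /mx_of_tuple !mxE.
by move=> h i j; rewrite /mx_of_tuple !mxE.
Qed.

End ApproximationEvents.

(** * Measures of finite unions of events *)

Section FiniteUnions.
Context d (T : measurableType d) (R : realType) (mu : probability T R).
Context (I : eqType) (E : I -> set T) (p : I -> R).
Hypothesis mE : forall i, measurable (E i).

Let U (s : seq I) := \big[setU/set0]_(i <- s) E i.

Let mU s : measurable (U s).
Proof. by apply: bigsetU_measurable. Qed.

Let UcapE A s : measurable A ->
  fine (mu (A `|` U s)) + fine (mu (A `&` U s)) = fine (mu A) + fine (mu (U s)).
Proof.
move=> mA; have fin B : measurable B -> mu B \is a fin_num by exact:
  fin_num_measure.
have h1 : mu (A `|` U s) = (mu A + mu (U s `\` A))%E.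
  rewrite -measureU//; first last.
  - by rewrite setDE setICA setICr setI0.
  - exact: measurableD.
  - congr (mu _); apply/seteqP; split=> x /=.
      by case=> [Ax|Ux]; [left|have [Ax|nAx] := pselect (A x); [left|right]].
    by case=> [Ax|[Ux _]]; [left|right].
have h2 : mu (U s) = (mu (A `&` U s) + mu (U s `\` A))%E.
  rewrite -measureU//.
  - by rewrite setIC setUIDK.
  - exact: measurableI.
  - exact: measurableD.
  - by apply/seteqP; split=> x //= -[[? _] [_ ]].
by rewrite h1 h2 !fineD ?fin//; [ring|exact: measurableI|exact: measurableD..].
Qed.

Lemma measure_bigsetU_le (s : seq I) (q : I -> R) :
  (forall i, i \in s -> (mu (E i) <= (q i)%:E)%E) ->
  (mu (\big[setU/set0]_(i <- s) E i) <= (\sum_(i <- s) q i)%:E)%E.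
Proof.
elim: s => [|i s IH] h; first by rewrite !big_nil measure0.
rewrite !big_cons EFinD; apply: (le_trans (measureU2 _ _ _)) => //;
  first exact: mU.
apply: leeD; first by apply: h; rewrite mem_head.
by apply: IH => j js; apply: h; rewrite inE js orbT.
Qed.

Lemma measure_bigsetU_disjoint (s : seq I) : uniq s ->
  (forall i, i \in s -> mu (E i) = (p i)%:E) ->
  (forall i j, i \in s -> j \in s -> i != j -> E i `&` E j = set0) ->
  mu (\big[setU/set0]_(i <- s) E i) = (\sum_(i <- s) p i)%:E.
Proof.
elim: s => [|i s IH] /=; first by rewrite !big_nil measure0.
move=> /andP[is_ us] h dis; rewrite !big_cons measureU//=; first last.
- rewrite big_distrr /= big_seq big1// => j js.
  apply: dis; rewrite ?mem_head ?inE ?js ?orbT//.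
  by apply: contraNneq is_ => ->.
- exact: mU.
rewrite h ?mem_head// IH//.
- by move=> j js; apply: h; rewrite inE js orbT.
- by move=> j k js ks; apply: dis; rewrite inE ?js ?ks orbT.
Qed.

(* Bonferroni: the measure of the union is at least [S - S ^ 2 / 2]. *)
Lemma measure_bigsetU_quasi_indep (s : seq I) : uniq s ->
  (forall i, i \in s -> mu (E i) = (p i)%:E) ->
  (forall i j, i \in s -> j \in s -> i != j ->
     (mu (E i `&` E j) <= (p i * p j)%:E)%E) ->
  \sum_(i <- s) p i <= 1 ->
  (((\sum_(i <- s) p i) / 2)%:E <= mu (\big[setU/set0]_(i <- s) E i))%E.
Proof.
move=> us h ind S1; pose S t := \sum_(i <- t) p i.
have p0 i : i \in s -> 0 <= p i by move=> /h; rewrite -lee_fin => <-.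
have S0 : 0 <= S s by rewrite /S big_seq; exact: sumr_ge0.
(* The induction runs over lists contained in [s], which keeps the hypotheses on members of [s]
   available. The bound suffices since [S s] lies in [[0, 1]]. *)
suff : forall t, uniq t -> {subset t <= s} -> S t - S t ^+ 2 / 2 <=
  fine (mu (U t)).
  move=> /(_ s us (fun i => id)) le; rewrite -[leRHS]fineK;
    last by rewrite fin_num_measure//; exact: mU.
  rewrite lee_fin; apply: le_trans le; rewrite -/(S s); rewrite -/(S s) in S1.
  nra.
elim=> [|i t IH] /=; first by rewrite /S /U !big_nil measure0 /=; lra.
move=> /andP[it ut] sub.
have is_ : i \in s by apply: sub; rewrite mem_head.
have ts : {subset t <= s} by move=> j jt; apply: sub; rewrite inE jt orbT.
have := IH ut ts; have := UcapE t (mE i).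
rewrite /U !big_cons -/(U t) h//=.
have cap : fine (mu (E i `&` U t)) <= p i * S t.
  rewrite -lee_fin fineK; last first.
    by rewrite fin_num_measure//; apply: measurableI => //; exact: mU.
  rewrite /U big_distrr /= /S mulr_sumr.
  elim: t it {ut IH sub} ts => [|j t IH] it ts;
    first by rewrite !big_nil measure0.
  rewrite !big_cons EFinD; apply: (le_trans (measureU2 _ _ _)).
  - exact: measurableI.
  - by apply: bigsetU_measurable => k _; exact: measurableI.
  apply: leeD; first by apply: ind => //; [apply: ts; rewrite mem_head|move: it;
    rewrite inE => /norP[]].
  apply: IH; first by move: it; rewrite inE => /norP[].
  by move=> k kt; apply: ts; rewrite inE kt orbT.
rewrite /S big_cons -/(S t) => eqU leU; have := p0 i is_.
have -> : (p i + S t) - (p i + S t) ^+ 2 / 2 =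
  (S t - S t ^+ 2 / 2) + p i - p i * S t - p i ^+ 2 / 2 by field.
have : 0 <= p i ^+ 2 by exact: sqr_ge0.
lra.
Qed.

End FiniteUnions.

(** * Vitali covering for balls on the torus *)

Section Vitali.
Context (R : realType) (m : nat).
Implicit Types x y : 'rV[R]_m.

Lemma torus_ball_le x r s : r <= s -> torus_ball x r `<=` torus_ball x s.
Proof. by move=> rs y h j; have [z hz] := h j; exists z; exact: lt_le_trans rs.
Qed.

Lemma torus_ball_engulf x y r s : r <= s ->
  torus_ball x r `&` torus_ball y s !=set0 ->
  torus_ball x (2 * r) `<=` torus_ball y (4 * s).
Proof.
move=> rs [u [ux uy]] w wx j.
have [a ha] := ux j; have [b hb] := uy j; have [c hc] := wx j.
(* Write [w - y = (w - x) - (u - x) + (u - y)]; the integer parts combine likewise, and the errors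
   add up to less than [2 r + r + s], at most [4 s]. *)
exists (c - a + b); rewrite !(intrD, intrB).
move: ha hb hc; rewrite !ltr_norml => /andP[? ?] /andP[? ?] /andP[? ?].
by apply/andP; split; lra.
Qed.

(** Greedy selection from the largest ball down: as the list increases, induction treats its head
    after all larger balls. A rejected ball meets a selected one at least as large, whose fourfold
    enlargement contains the double of the rejected ball. *)
Lemma vitali_torus (I : eqType) (x : I -> 'rV[R]_m) (r : I -> R) (s : seq I) :
  (forall i, 0 <= r i) -> sorted (fun i j => r i <= r j) s ->
  exists t : seq I, [/\ subseq t s,
    forall i j, i \in t -> j \in t -> i != j ->
      torus_ball (x i) (r i) `&` torus_ball (x j) (r j) = set0 &
    forall i, i \in s -> exists2 j, j \in t &
      torus_ball (x i) (2 * r i) `<=` torus_ball (x j) (4 * r j)].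
Proof.
move=> r0; elim: s => [_|i s IH srt]; first by exists [::].
have le_i j : j \in s -> r i <= r j.
  have tr : transitive (fun i j => r i <= r j) by move=> ? ? ?; exact: le_trans.
  by move: srt; rewrite /= path_sortedE// => /andP[/allP h _]; exact: h.
have [t [sub dis cov]] := IH (path_sorted srt).
have [[j jt meet]|none] := pselect (exists2 j, j \in t &
    torus_ball (x i) (r i) `&` torus_ball (x j) (r j) !=set0).
  exists t; split=> //; first exact: subseq_trans sub (subseq_cons _ _).
  move=> k; rewrite inE => /orP[/eqP ->|]; last exact: cov.
  by exists j => //; apply: torus_ball_engulf => //; apply: le_i;
    exact: (mem_subseq sub).
have dis_i j : j \in t -> torus_ball (x i) (r i) `&` torus_ball (x j) (r j) =
  set0.
  move=> jt; apply: contrapT => /eqP/set0P meet; apply: none; exists j => //.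
exists (i :: t); split=> /=; first by rewrite eqxx.
  move=> j k; rewrite !inE => /orP[/eqP ->|jt] /orP[/eqP ->|kt] jk.
  - by rewrite eqxx in jk.
  - exact: dis_i.
  - by rewrite setIC; exact: dis_i.
  - exact: dis.
move=> j; rewrite inE => /orP[/eqP ->|js].
  by exists i; rewrite ?mem_head//; apply: torus_ball_le; have := r0 i; lra.
by have [k kt kj] := cov j js; exists k => //; rewrite inE kt orbT.
Qed.

End Vitali.

(** * Splitting a radius among finitely many vectors of given gcd *)

Section Radii.
Context (R : realType) (n m : nat).
Hypothesis m0 : (0 < m)%N.

(** A finite partial sum of the defining series already exceeds [rho ^+ m / 2], even if the series
    diverges. If it overshoots [rho ^+ m], all values are shrunk by a common factor, the first
    component of [lV]. *)
Lemma PsiQ_select (psi : 'rV[nat]_n -> R) (d : nat) (rho : R) :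
  (forall q, 0 <= psi q) -> 0 <= rho -> (rho%:E <= PsiQ m psi 1 d)%E ->
  exists lV : R * seq 'rV[nat]_n, [/\ 0 <= lV.1 <= 1, uniq lV.2,
    forall q, q \in lV.2 -> gcdv q = d &
    rho ^+ m / 2 <= \sum_(q <- lV.2) (lV.1 * psi q) ^+ m <= rho ^+ m].
Proof.
move=> psi0; rewrite le_eqVlt => /orP[/eqP <- _|rho0 le_rho].
  exists (0, [::]); split=> //=; rewrite ?lexx ?ler01//.
  by rewrite big_nil expr0n eqn0Ngt m0 /= mul0r lexx.
have rm0 : 0 < rho ^+ m by rewrite exprn_gt0.
have mR0 : (m%:R : R) != 0 by rewrite pnatr_eq0 -lt0n.
have rootK (a : R) : 0 <= a -> (a `^ m%:R^-1) ^+ m = a.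
  by move=> a0; rewrite -powR_mulrn ?powR_ge0// -powRrM mulVf// powRr1.
have : ((rho ^+ m / 2)%:E < \esum_(q in [set q : 'rV[nat]_n |
        gcdv q = d /\ 1 <= `|(gcdv q)%:R^-1 *:
          natmx R q|]%R) ((psi q ^+ m)%R)%:E)%E.
  apply: (@lt_le_trans _ _ (rho ^+ m)%:E); first by rewrite lte_fin; lra.
  move: le_rho; rewrite /PsiQ; set e := esum _ _.
  have : (0 <= e)%E by apply: esum_ge0 => q _; rewrite lee_fin exprn_ge0.
  case: e => [e| |] //; last by move=> *; rewrite leey.
  rewrite poweR_EFin !lee_fin => e0 h.
  have : rho ^+ m <= (e `^ m%:R^-1) ^+ m by rewrite lerXn2r// nnegrE ?powR_ge0//
    ltW.
  by rewrite rootK.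
move=> /ereal_sup_gt[_ [X [finX subX] <-]].
have /finite_seqP[s0 Xs0] := finX; pose s := undup s0.
have us : uniq s by exact: undup_uniq.
have Xs : X = [set` s] by rewrite Xs0; apply/seteqP; split=> q /=;
  rewrite mem_undup.
rewrite Xs -fsbig_seq//= sumEFin lte_fin; set S := \sum_(q <- s) _ => SS.
have sd q : q \in s -> gcdv q = d by move=> qs; have [] := subX q; rewrite ?Xs.
have [Sle|Sgt] := leP S (rho ^+ m).
  exists (1, s); split => //=; rewrite ?lexx ?ler01//.
  by under eq_bigr do rewrite mul1r; rewrite -/S Sle (ltW SS).
have S0 : 0 < S by exact: lt_trans Sgt.
(* This factor makes the sum of powers exactly [rho ^+ m]. *)
exists ((rho ^+ m / S) `^ m%:R^-1, s); split=> //=.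
  rewrite powR_ge0/= [leRHS](_ : 1 = 1 `^ m%:R^-1); last by rewrite powR1.
  apply: ge0_ler_powR; rewrite ?nnegrE ?divr_ge0// ?(ltW rm0) ?(ltW S0)//.
  by rewrite ler_pdivrMr// mul1r ltW.
under eq_bigr do rewrite exprMn.
rewrite -mulr_sumr -/S rootK; last by rewrite divr_ge0// ltW.
rewrite divfK ?gt_eqF// lexx andbT; lra.
Qed.

End Radii.

(** * From disjoint balls to a lower bound for approximation beyond [D] *)

Section Transference.
Context (R : realType) (n m : nat).
Hypothesis m0 : (0 < m)%N.
Variable P : nat -> {fset 'rV[R]_m}.
Hypothesis hP : torus_family P.
Local Notation RR := (measurableTypeR R).

Lemma primitive_part_gcd (q : 'rV[nat]_n) : q != 0 ->
  \big[gcdn/0%N]_(i < n) primitive_part q i = 1%N.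
Proof.
rewrite -gcdv_gt0 => d0; apply/eqP; rewrite -(eqn_pmul2l d0) muln1; apply/eqP.
rewrite (big_morph _ (muln_gcdr (gcdv q)) (muln0 _)) [RHS]/gcdv.
by apply: eq_bigr => i _; rewrite primitive_partK.
Qed.

(** With [v], [w] the primitive parts, [v i] is the gcd over [j] of [v i * w j = v j * w i], which
    is [w i] because both have gcd 1. *)
Lemma primitive_part_proportional (q q' : 'rV[nat]_n) : q != 0 -> q' != 0 ->
  (forall i j, primitive_part q i * primitive_part q' j =
               primitive_part q j * primitive_part q' i)%N ->
  primitive_part q = primitive_part q'.
Proof.
move=> q0 q0' h; apply/funext => i.
rewrite -[LHS]muln1 -[in LHS](primitive_part_gcd q0') -[RHS]mul1n.
rewrite -[in RHS](primitive_part_gcd q0).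
rewrite (big_morph _ (muln_gcdr _) (muln0 _)) (big_morph _ (fun x y =>
  muln_gcdl x y _) (mul0n _)).
by apply: eq_bigr => j _; exact: h.
Qed.

Lemma primitive_part_pos (q : 'rV[nat]_n) : q != 0 ->
  exists i, (0 < primitive_part q i)%N.
Proof.
move=> q0; apply: contrapT => h; have := primitive_part_gcd q0.
rewrite big1// => i _; apply/eqP; rewrite eqn0Ngt; apply/negP => vi.
by apply: h; exists i.
Qed.

Section Radius.
Variable psi : 'rV[nat]_n -> R.
Hypothesis psi0 : forall q, 0 <= psi q.

(* The cap [d / 2] keeps the radii finite and each ball of radius
   [radius d / d] injectively embedded in the torus. *)
Definition radius (d : nat) : R :=
  fine (Order.min (PsiQ m psi 1 d) (d%:R / 2)%:E).

Lemma PsiQ_ge0 d : (0 <= PsiQ m psi 1 d)%E.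
Proof. exact: poweR_ge0. Qed.

Lemma radius_fin d :
  (radius d)%:E = Order.min (PsiQ m psi 1 d) (d%:R / 2)%:E.
Proof.
rewrite /radius fineK// ge0_fin_numE.
  by rewrite (@le_lt_trans _ _ (d%:R / 2)%:E)// ?ltry// ge_min lexx orbT.
by rewrite le_min PsiQ_ge0 lee_fin divr_ge0.
Qed.

Lemma radius_ge0 d : 0 <= radius d.
Proof.
by rewrite -lee_fin radius_fin le_min PsiQ_ge0 lee_fin divr_ge0.
Qed.

Lemma radius_le d : radius d <= d%:R / 2.
Proof. by rewrite -lee_fin radius_fin ge_min lexx orbT. Qed.

Lemma radius_le_PsiQ d : ((radius d)%:E <= PsiQ m psi 1 d)%E.
Proof. by rewrite radius_fin ge_min lexx. Qed.

Lemma torus_ball_large (x y : 'rV[R]_m) : torus_ball x 1 y.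
Proof.
move=> j; exists (Num.floor (y 0 j - x 0 j)).
rewrite ger0_norm ?subr_ge0 ?floor_le_tmp//.
by rewrite ltrBlDl; have := floorD1_gt (y 0 j - x 0 j); rewrite intrD.
Qed.

Lemma gcdv1 (q : 'rV[nat]_1) : gcdv q = q 0 0.
Proof. by rewrite /gcdv big_ord1. Qed.

(** The doubling pays for the cap: where the cap is active, [radius d / d] is one half, and the open
    ball of radius 1 is the whole torus. *)
Lemma W1_cover (D : nat) :
  @mx_of_tuple R 1 m @^-1` W1 P (PsiQ m psi 1) `<=`
  \bigcup_k \bigcup_(p in [set` P (D.+1 + k)%N])
    form_event (fun _ : 'I_1 => 1%N) ((D.+1 + k)%:R^-1 *: p)
      (2 * (radius (D.+1 + k) / (D.+1 + k)%:R)).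
Proof.
move=> t inf.
have [q [[q0 tq] Dq]] : exists q : 'rV[nat]_1,
    (q != 0 /\ approx_set P q (PsiQ m psi 1 (q 0 0)) (mx_of_tuple t)) /\
    (D < q 0%R 0%R)%N.
  (* Otherwise every admissible [q] is one of the finitely many one-entry rows with entry at most
     [D]. *)
  apply: contrapT => none; apply: inf.
  apply: (@sub_finite_set _ _ [set` [seq const_mx i | i <- iota 0 D.+1]]);
    last exact: finite_seq.
  move=> q hq; apply/mapP; exists (q 0 0); last by apply/rowP => i;
    rewrite (ord1 i) mxE.
  by rewrite mem_iota /= add0n ltnS leqNgt; apply/negP => Dq; apply: none;
    exists q.
exists (q 0%R 0%R - D.+1)%N => //; rewrite subnKC//; set d := q 0 0 in tq Dq *.
have d0 : (0 < d)%N by apply: leq_ltn_trans Dq.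
have d0R : 0 < d%:R :> R by rewrite ltr0n.
have v1 : primitive_part q = fun _ => 1%N.
  by apply/funext => i; rewrite (ord1 i) /primitive_part gcdv1 divnn d0.
have [le_d|gt_d] := leP (PsiQ m psi 1 d) (d%:R / 2)%:E.
  have e : PsiQ m psi 1 d = (radius d)%:E by rewrite radius_fin;
    apply/esym/min_idPl.
  have : (@mx_of_tuple R 1 m @^-1` approx_set P q (radius d)%:E) t by rewrite /=
    -e.
  rewrite approx_set_fin// v1 gcdv1 => -[p pP tp]; exists p => //.
  apply: torus_ball_le tp; rewrite -[leLHS]mul1r ler_wpM2r ?divr_ge0
    ?radius_ge0//.
  by rewrite ler1n.
have -> : radius d = d%:R / 2.
  by apply: EFin_inj; rewrite radius_fin; apply/min_idPr/ltW.
have [p pP] : exists p, p \in P d by have [/fset0Pn] := hP d0.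
exists p => //; rewrite /form_event /= (_ : 2 * _ = 1);
  first exact: torus_ball_large.
by field; rewrite gt_eqF.
Qed.


Let rad (i : nat * 'rV[R]_m) : R := radius i.1 / i.1%:R.
Let cen (i : nat * 'rV[R]_m) : 'rV[R]_m := i.1%:R^-1 *: i.2.
Let v1 : 'I_1 -> nat := fun=> 1%N.

Let rad_ge0 i : 0 <= rad i.
Proof. by rewrite /rad divr_ge0// radius_ge0. Qed.

Let rad_le i : rad i <= 2^-1.
Proof.
have [i0|i0] := eqVneq i.1 0%N; first by rewrite /rad i0 invr0 mulr0 invr_ge0.
by rewrite /rad ler_pdivrMr ?ltr0n ?lt0n// mulrC radius_le.
Qed.

Let v1_measure x r : 0 <= r -> r <= 2^-1 ->
  cube_prob R (1 * m) (form_event v1 x r) = ((2 * r) ^+ m)%:E.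
Proof. exact: (@cube_prob_form_event R 1 m v1 x r ord0 isT). Qed.

Let v1_measure_le x r : 0 <= r ->
  (cube_prob R (1 * m) (form_event v1 x r) <= ((2 * r) ^+ m)%:E)%E.
Proof.
move=> r0; have [r1|r1] := leP r 2^-1; first by rewrite v1_measure// lexx.
apply: (@le_trans _ _ 1%E); first by apply: probability_le1;
  exact: measurable_form_event.
by rewrite lee_fin exprn_ege1//; lra.
Qed.

(** The upper bound 1 on the sum comes from disjointness in a probability space, the lower bound
    from the covering property, with the loss [4 ^+ m] of the enlargement. *)
Lemma disjoint_balls (D : nat) (kappa : R) :
  (0 < kappa)%R ->
  (kappa%:E < torus_lebesgue (W1 P (PsiQ m psi 1)))%E ->
  exists t : seq (nat * 'rV[R]_m), [/\ uniq t,
    forall i, i \in t -> (D < i.1)%N /\ i.2 \in P i.1,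
    forall i j, i \in t -> j \in t -> i != j ->
      torus_ball (cen i) (rad i) `&` torus_ball (cen j) (rad j) = set0 &
    kappa / 4 ^+ m <= \sum_(i <- t) (2 * rad i) ^+ m <= 1].
Proof.
move=> kappa0; rewrite torus_lebesgueE; last exact: measurable_W.
set mu := cube_prob R (1 * m) => kappaW.
pose G d := \bigcup_(p in [set` P d])
  form_event v1 (d%:R^-1 *: p) (2 * (radius d / d%:R)).
pose F k := \big[setU/set0]_(i < k) G (D.+1 + i)%N.
have mG d : measurable (G d).
  by apply: fin_bigcup_measurable => // p _; exact: measurable_form_event.
have mF k : measurable (F k) by exact: bigsetU_measurable.
(* Continuity from below along the increasing sets [F k], whose union contains [W1], leaves finitely
   many balls to select from. *)
have [k Fk] : exists k, (kappa%:E < mu (F k))%E.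
  apply: contrapT => none.
  have leF k : (mu (F k) <= kappa%:E)%E.
    by rewrite leNgt; apply/negP => h; apply: none; exists k.
  have cvF : mu (F k) @[k --> \oo] --> mu (\bigcup_k F k).
    apply: nondecreasing_cvg_mu => //; first exact: bigcupT_measurable.
    by move=> k l kl; apply/subsetPset;
      exact: (@subset_bigsetU _ (fun i => G (D.+1 + i)%N)).
  have : (mu (\bigcup_k F k) <= kappa%:E)%E.
    rewrite -(cvg_lim _ cvF)//; apply: lime_le; first exact: cvgP cvF.
    exact: nearW.
  rewrite leNgt => /negP; apply; apply: (lt_le_trans kappaW).
  apply: le_measure; rewrite ?inE; [exact: measurable_W|exact:
    bigcupT_measurable|].
  move=> t /(@W1_cover D)[k _ Gk]; exists k.+1 => //.
  by rewrite /F big_ord_recr; right.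
pose s0 := [seq (d, p) | d <- iota D.+1 k, p <- enum_fset (P d)].
pose leT (i j : nat * 'rV[R]_m) := rad i <= rad j.
pose s := sort leT s0.
have us0 : uniq s0.
  apply: allpairs_uniq_dep; [exact: iota_uniq|by move=> d _; exact: fset_uniq|].
  by move=> [a b] [c d] /= _ _ [-> ->].
have srt : sorted leT s by apply: sort_sorted => i j; exact: le_total.
have [t [sub dis cov]] := vitali_torus cen rad_ge0 srt.
have ut : uniq t by apply: subseq_uniq sub _; rewrite sort_uniq.
have tP i : i \in t -> (D < i.1)%N /\ i.2 \in P i.1.
  move=> /(mem_subseq sub); rewrite mem_sort =>
    /allpairsPdep[d [p [dk pP ->]]] /=.
  by split => //; move: dk; rewrite mem_iota => /andP[].
exists t; split=> //.
have mE i : measurable (form_event v1 (cen i) (rad i)) by exact: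
  measurable_form_event.
apply/andP; split; last first.
  rewrite -lee_fin -(measure_bigsetU_disjoint (mu := mu) mE ut).
  - by apply: probability_le1; apply: bigsetU_measurable => i _; exact: mE.
  - by move=> i it; apply: v1_measure.
  - by move=> i j it jt ij; rewrite -preimage_setI (dis i j)// preimage_set0.
rewrite ler_pdivrMr ?exprn_gt0// mulr_suml -lee_fin; apply: (le_trans (ltW Fk)).
pose E4 i := form_event v1 (cen i) (4 * rad i).
have mE4 i : measurable (E4 i) by exact: measurable_form_event.
apply: (@le_trans _ _ (mu (\big[setU/set0]_(i <- t) E4 i))).
  apply: le_measure; rewrite ?inE//.
    by apply: bigsetU_measurable => i _; exact: mE4.
  rewrite /F -(bigcup_mkord k (fun i => G (D.+1 + i)%N)) => x [i /=
    ik [p pP xp]].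
  have ips : ((D.+1 + i)%N, p) \in s.
    by rewrite mem_sort; apply/allpairsPdep; exists (D.+1 + i)%N, p;
      rewrite mem_iota leq_addr ltn_add2l.
  have [j jt ij] := cov _ ips.
  by rewrite -bigcup_seq; exists j => //; exact: ij.
apply: measure_bigsetU_le => // i _.
apply: le_trans (v1_measure_le _ _) _; first by rewrite mulr_ge0.
by rewrite lee_fin -exprMn mulrCA [4 * _]mulrC lexx.
Qed.

Lemma measurable_approx_beyond (D : nat) : measurable
  (\bigcup_(q in [set q : 'rV[nat]_n | (D < gcdv q)%N])
      @mx_of_tuple R n m @^-1` approx_set P q (psi q)%:E).
Proof.
rewrite bigcup_mkcond; apply: countable_bigcupT_measurable => // q.
case: ifPn => //; rewrite inE /= => Dq; apply: measurable_approx => //.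
by rewrite -gcdv_gt0; exact: leq_ltn_trans Dq.
Qed.

(** The factor [4 ^+ m] is the Vitali loss; the last 4 is a factor 2 from [PsiQ_select] times a
    factor 2 from Bonferroni. The bound does not depend on [D]. *)
Lemma approx_beyond_measure (D : nat) (kappa : R) :
  (0 < kappa)%R ->
  (kappa%:E < torus_lebesgue (W1 P (PsiQ m psi 1)))%E ->
  ((kappa / 4 ^+ m / 4)%:E <= cube_prob R (n * m)
    (\bigcup_(q in [set q : 'rV[nat]_n | (D < gcdv q)%N])
      @mx_of_tuple R n m @^-1` approx_set P q (psi q)%:E))%E.
Proof.
move=> kappa0 kappaW; have [t [ut tP dis /andP[geS leS]]] :=
  disjoint_balls D kappa0 kappaW.
have /choice[f fP] d := PsiQ_select m0 psi0 (radius_ge0 d) (radius_le_PsiQ d).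
(* An index pairs a selected ball [(d, p)] with a vector [q] of gcd [d]; [rho] is the radius of the
   concentric ball assigned to it. *)
pose rho (i : (nat * 'rV[R]_m) * 'rV[nat]_n) :=
  (f i.1.1).1 * psi i.2 / i.1.1%:R.
pose s := [seq (i, q) | i <- t, q <- (f i.1).2].
pose E i := form_event (primitive_part i.2) (cen i.1) (rho i).
have us : uniq s.
  apply: allpairs_uniq_dep => // [i _|]; first by have [] := fP i.1.
  by move=> [a b] [c d] /= _ _ [-> ->].
have sP i : i \in s -> [/\ i.1 \in t, i.2 != 0, gcdv i.2 = i.1.1 &
    0 <= rho i <= rad i.1].
  move=> /allpairsPdep[j [q [jt qV ->]]] /=.
  have [/andP[l0 l1] uV gV /andP[_ le_r]] := fP j.1.
  have gq := gV _ qV; have [Dj _] := tP _ jt.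
  have j0 : (0 < j.1)%N by exact: leq_ltn_trans Dj.
  split=> //; first by rewrite -gcdv_gt0 gq.
  rewrite /rho /= divr_ge0 ?mulr_ge0// ler_pM2r ?invr_gt0 ?ltr0n//=.
  (* A single term of the sum bounded by [radius d ^+ m] obeys the same bound, so the new ball lies
     in the original one. *)
  rewrite -(ler_pXn2r m0) ?nnegrE ?mulr_ge0 ?radius_ge0//.
  apply: le_trans le_r; rewrite (bigD1_seq q)//= lerDl.
  by apply: sumr_ge0 => k _; rewrite exprn_ge0 ?mulr_ge0.
have mE i : measurable (E i) by exact: measurable_form_event.
pose p i := (2 * rho i) ^+ m.
have sumE : \sum_(i <- s) p i =
    \sum_(i <- t) (2 / i.1%:R) ^+ m *
      \sum_(q <- (f i.1).2) ((f i.1).1 * psi q) ^+ m.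
  rewrite big_allpairs_dep; apply: eq_bigr => i _; rewrite mulr_sumr.
  apply: eq_bigr => q _; rewrite /p /rho /= -exprMn; congr (_ ^+ _); ring.
have radE i : (2 * rad i) ^+ m = (2 / i.1%:R) ^+ m * radius i.1 ^+ m.
  by rewrite -exprMn; congr (_ ^+ _); rewrite /rad; ring.
have c0 i : 0 <= (2 / i%:R) ^+ m :> R by rewrite exprn_ge0// divr_ge0.
have sum_le : \sum_(i <- s) p i <= 1.
  rewrite sumE; apply: le_trans leS; apply: ler_sum => i _; rewrite radE.
  by apply: ler_wpM2l => //; have [_ _ _ /andP[]] := fP i.1.
have sum_ge : kappa / 4 ^+ m / 2 <= \sum_(i <- s) p i.
  apply: (@le_trans _ _ ((\sum_(i <- t) (2 * rad i) ^+ m) / 2)).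
    by rewrite ler_pM2r ?invr_gt0.
  rewrite sumE mulr_suml; apply: ler_sum => i _; rewrite radE -mulrA.
  by apply: ler_wpM2l => //; have [_ _ _ /andP[]] := fP i.1.
have prE i : i \in s -> cube_prob R (n * m) (E i) = (p i)%:E.
  move=> /sP[_ q0 _ /andP[r0 r1]]; have [k vk] := primitive_part_pos q0.
  by apply: cube_prob_form_event vk r0 _; exact: le_trans r1 (rad_le _).
apply: (@le_trans _ _ (cube_prob R (n * m) (\big[setU/set0]_(i <- s) E i)));
  last first.
  apply: le_measure; rewrite ?inE.
  - by apply: bigsetU_measurable => i _; exact: mE.
  - exact: measurable_approx_beyond.
  - rewrite -bigcup_seq => x [i /= /[dup] /sP[it q0 gq /andP[r0 r1]] is_ xi].
    have [Di iP] := tP _ it; exists i.2; first by rewrite /= gq.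
    rewrite approx_set_fin// gq; exists i.1.2 => //.
    apply: torus_ball_le xi; rewrite /rho ler_wpM2r ?invr_ge0//.
    have [/andP[_ l1] _ _ _] := fP i.1.1.
    by rewrite -[leRHS]mul1r ler_wpM2r.
apply: le_trans (measure_bigsetU_quasi_indep mE us prE _ sum_le).
  by rewrite lee_fin; lra.
move=> i j /[dup] is_ /sP[it qi gi /andP[ri0 ri1]] /[dup] js /sP[jt qj gj
  /andP[rj0 rj1]] ij.
(* A nonzero minor gives independence. If all minors vanish, the primitive parts coincide, and the
   events are pulled back from disjoint balls by the same form. *)
have [[k [l kl]]|prop] := pselect (exists k l,
    (primitive_part i.2 l * primitive_part j.2 k <
     primitive_part i.2 k * primitive_part j.2 l)%N).
  rewrite (cube_prob_form_event2 _ _ kl) ?lexx//; apply: le_trans (rad_le _);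
    [exact: ri1|exact: rj1].
have vv : primitive_part i.2 = primitive_part j.2.
  apply: (primitive_part_proportional qi qj) => k l.
  have [h|h|//] := ltngtP (primitive_part i.2 k * primitive_part j.2 l)%N
    (primitive_part i.2 l * primitive_part j.2 k)%N.
    by case: prop; exists l, k.
  by case: prop; exists k, l.
(* Equal balls with equal primitive parts would give equal [q], since [q] is its gcd times its
   primitive part. *)
have ij1 : i.1 != j.1.
  apply: contra ij => /eqP e; rewrite -pair_eqE /pair_eq e eqxx /=;
    apply/eqP/rowP => k.
  by rewrite -(primitive_partK i.2) -(primitive_partK j.2) gi gj vv e.
have Eij : E i `&` E j = set0.
  rewrite /E vv -preimage_setI -subset0 => y [yi yj].
  have : (torus_ball (cen i.1) (rad i.1) `&` torus_ball (cen j.1) (rad j.1))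
      (form_row (primitive_part j.2) y).
    by split; [exact: torus_ball_le yi|exact: torus_ball_le yj].
  by rewrite dis.
have p0 k : 0 <= rho k -> 0 <= p k.
  by move=> k0; apply: exprn_ge0; apply: mulr_ge0.
by rewrite Eij measure0 lee_fin; apply: mulr_ge0; exact: p0.
Qed.

End Radius.
End Transference.

(** * Passage to the limit set *)

Section Limsup.
Context (R : realType) (n m : nat).
Hypothesis m0 : (0 < m)%N.
Variable P : nat -> {fset 'rV[R]_m}.
Hypothesis hP : torus_family P.

Lemma torus_lebesgue_W_gt0 (psi : 'rV[nat]_n -> R) : (forall q, 0 <= psi q) ->
  (0 < torus_lebesgue (W1 P (PsiQ m psi 1)))%E ->
  (0 < torus_lebesgue (W P (fun q => (psi q)%:E)))%E.
Proof.
move=> psi0 W1_gt0.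
(* A real [kappa] strictly below the measure is fixed before [D], so that one constant [c] serves
   all the sets [H D]; these decrease, and continuity from above applies. *)
have [kappa kappa0 kappaW] : exists2 kappa : R, 0 < kappa &
    (kappa%:E < torus_lebesgue (W1 P (PsiQ m psi 1)))%E.
  move: W1_gt0; case: (torus_lebesgue _) => [r| |]//.
    by rewrite lte_fin => r0; exists (r / 2); rewrite ?lte_fin; lra.
  by exists 1 => //; exact: ltry.
pose c := kappa / 4 ^+ m / 4.
have c0 : 0 < c by rewrite !divr_gt0 ?exprn_gt0.
rewrite torus_lebesgueE; last exact: measurable_W.
pose H D : set ((n * m).-tuple (measurableTypeR R)) :=
  \bigcup_(q in [set q : 'rV[nat]_n | (D < gcdv q)%N])
      @mx_of_tuple R n m @^-1` approx_set P q (psi q)%:E.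
have mH D : measurable (H D) by exact: measurable_approx_beyond.
apply: (@lt_le_trans _ _ c%:E); first by rewrite lte_fin.
apply: (@le_trans _ _ (cube_prob R (n * m) (\bigcap_D H D))); last first.
  apply: le_measure; rewrite ?inE; [exact: bigcapT_measurable|exact:
    measurable_W|].
  move=> t Ht /finite_seqP[X XE].
  (* If only finitely many [q] worked, taking [D] as their largest gcd would produce one more. *)
  have [q /= Dq tq] := Ht (\max_(q <- X) gcdv q) I.
  have : q \in X.
    rewrite -[is_true _]/([set` X] q) -XE; split=> //.
    by rewrite -gcdv_gt0; exact: leq_ltn_trans Dq.
  by move=> qX; move: Dq; rewrite ltnNge leq_bigmax_seq.
have cvH : cube_prob R (n * m) (H D) @[D --> \oo] -->
    cube_prob R (n * m) (\bigcap_D H D).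
  apply: nonincreasing_cvg_mu => //.
  - by apply: (le_lt_trans (probability_le1 _ (mH 0%N))); exact: ltry.
  - exact: bigcapT_measurable.
  - move=> D D' DD; apply/subsetPset => t [q /= Dq tq]; exists q => //=.
    exact: leq_ltn_trans Dq.
rewrite -(cvg_lim _ cvH)//; apply: lime_ge; first exact: cvgP cvH.
by apply: nearW => D; exact: approx_beyond_measure kappaW.
Qed.

End Limsup.

Theorem theorem1p2 (R : realType) (n m : nat) (hn : (0 < n)%N) (hm : (0 < m)%N)
  (P : nat -> {fset 'rV[R]_m}) (hP : torus_family P) :
  (relatively_well_spread P ->
   forall psi : 'rV[nat]_n -> R, (forall q, 0 <= psi q) ->
     (0 < torus_lebesgue (W1 P (PsiQ m psi 1)))%E ->
     (0 < torus_lebesgue (W P (fun q => (psi q)%:E)))%E) /\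
  (relatively_uniformly_discrete P ->
   forall psi : 'rV[nat]_n -> R, (forall q, 0 <= psi q) ->
     (exists M : R, forall q, psi q <= M) ->
     (0 < torus_lebesgue (W1 P (PsiQ m psi 1)))%E ->
     (0 < torus_lebesgue (W P (fun q => (psi q)%:E)))%E).
Proof.
split=> _ psi psi0; first exact: torus_lebesgue_W_gt0.
by move=> _; exact: torus_lebesgue_W_gt0.
Qed.
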